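(* Consider the quadratic-bilinear (QB) system given by the real matrices $A,N_1,\dots,N_m\in\mathbb{R}^{n\times n}$, $H\in\mathbb{R}^{n\times n^2}$ (symmetric as a Hessian), $B\in\mathbb{R}^{n\times m}$, $C\in\mathbb{R}^{p\times n}$, with $A$ stable. Let $P_{\mathcal T}$ and $Q_{\mathcal T}$ be its truncated reachability and observability Gramians. Let the reduced-order system of order $\hat n$, with matrices $\hat A,\hat H$ and projection matrices $\mathcal V,\mathcal W$, and let the diagonal matrix $\Sigma_1$ be determined by the square-root balanced truncation based on $P_{\mathcal T},Q_{\mathcal T}$ described in the context. Then, for the Lyapunov function $\mathcal F(\hat x)=\hat x^T\Sigma_1\hat x$, with derivative taken along the solutions of the autonomous reduced system $\dot{\hat x}=\hat A\hat x+\hat H(\hat x\otimes\hat x)$, $$\mathcal F(\hat x)>0,\qquad \tfrac{d}{dt}\mathcal F(\hat x)<0\qquad\text{for all }\hat x\in\mathcal B_{0,r}\setminus\{0\},$$ where $\mathcal B_{0,r}$ is the (open) ball of radius $r$ centered at $0$, $$r=\frac{\sigma_{\min}(\mathcal V^T\mathcal G\mathcal V)}{2\,\|\Sigma_1\|\,\|\hat H\|},\qquad \mathcal G=\mathcal{H}^{(2)}(P_1\otimes Q_1)(\mathcal{H}^{(2)})^T+\sum_{k=1}^mN_k^TQ_1N_k+C^TC,$$ and $P_1$, $Q_1$ are the solutions of $AP_1+P_1A^T+BB^T=0$ and $A^TQ_1+Q_1A+C^TC=0$.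
   Context: The QB system is $\dot x(t)=Ax(t)+H(x(t)\otimes x(t))+\sum_{k=1}^m N_kx(t)u_k(t)+Bu(t)$, $y(t)=Cx(t)$, $x(0)=0$; $\otimes$ is the Kronecker product. A matrix is stable if all its eigenvalues have negative real part. $H$ is symmetric, i.e. $H(u\otimes v)=H(v\otimes u)$ for all $u,v\in\mathbb{R}^n$. $\|\cdot\|$ is the Euclidean/spectral norm and $\sigma_{\min}$ the smallest singular value. Matricization: let $\mathcal{H}=(h_{ijk})\in\mathbb{R}^{n\times n\times n}$ be the tensor with $H_{i,(k-1)n+j}=h_{ijk}$; then $\mathcal{H}^{(2)}\in\mathbb{R}^{n\times n^2}$ is its mode-2 matricization, $\mathcal{H}^{(2)}_{j,(k-1)n+i}=h_{ijk}$, equivalently $\mathcal{H}^{(2)}(x\otimes z)=(x^T\otimes I_n)H^Tz$ for all $x,z\in\mathbb{R}^n$. Truncated Gramians: $P_{\mathcal T}$ and $Q_{\mathcal T}$ are the (positive semidefinite) solutions of $AP_{\mathcal T}+P_{\mathcal T}A^T+H(P_1\otimes P_1)H^T+\sum_{k=1}^mN_kP_1N_k^T+BB^T=0$ and $A^TQ_{\mathcal T}+Q_{\mathcal T}A+\mathcal{H}^{(2)}(P_1\otimes Q_1)(\mathcal{H}^{(2)})^T+\sum_{k=1}^mN_k^TQ_1N_k+C^TC=0$, with $P_1,Q_1$ as in the claim. Square-root balanced truncation: factor $P_{\mathcal T}=SS^T$, $Q_{\mathcal T}=RR^T$. Compute the singular value decomposition $S^TR=U\Sigma V^T=[U_1\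 U_2]\operatorname{diag}(\Sigma_1,\Sigma_2)[V_1\ V_2]^T$, where the diagonal matrix $\Sigma_1\in\mathbb{R}^{\hat n\times\hat n}$ contains the $\hat n$ largest singular values (all positive). Put $\mathcal V=SU_1\Sigma_1^{-1/2}$, $\mathcal W=RV_1\Sigma_1^{-1/2}$, and $\hat A=\mathcal W^TA\mathcal V$, $\hat H=\mathcal W^TH(\mathcal V\otimes\mathcal V)$, $\hat N_k=\mathcal W^TN_k\mathcal V$, $\hat B=\mathcal W^TB$, $\hat C=C\mathcal V$. The number $r$ is defined when $\hat H\ne0$. *)

(* Defs.v *)
From mathcomp Require Import all_boot all_order all_algebra.
From mathcomp Require Export complex mxtens.
From mathcomp Require Export all_classical all_reals all_analysis.

Set Implicit Arguments.
Unset Strict Implicit.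
Unset Printing Implicit Defensive.

Import Order.TTheory GRing.Theory Num.Theory.
Import numFieldNormedType.Exports.
Local Open Scope classical_set_scope.
Local Open Scope ring_scope.

(* The library norm on matrices is the entrywise maximum norm, so the Euclidean
   and spectral norms are defined here. *)
Definition enorm (R : realType) n (x : 'cV[R]_n) : R :=
  Num.sqrt (\sum_i x i 0 ^+ 2).

Definition spectral_norm (R : realType) m n (M : 'M[R]_(m, n)) : R :=
  sup [set enorm (M *m x) | x in [set x : 'cV[R]_n | enorm x <= 1]].

Definition singular_values (R : realType) n (M : 'M[R]_n) : set R :=
  [set s | 0 <= s /\ eigenvalue (M^T *m M) (s ^+ 2)].

(* The set is finite, and nonempty when n > 0, so [inf] is a minimum. *)
Definition sigma_min (R : realType) n (M : 'M[R]_n) : R :=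
  inf (singular_values M).

Definition stable (R : realType) n (A : 'M[R]_n) : Prop :=
  forall z : R[i], eigenvalue (map_mx (real_complex R) A) z -> complex.Re z < 0.

Definition symmetric_hessian (R : realType) n (H : 'M[R]_(n, n * n)) : Prop :=
  forall u v : 'cV[R]_n, H *m (u *t v) = H *m (v *t u).

(* With 0-based indices [mxtens_index (k, j)] is [k * n + j]: thus
   h_ijk = H i (mxtens_index (k, j)), and the entry of the mode-2
   matricization in row j and column (k, i) is h_ijk. *)
Definition mode2 (R : realType) n (H : 'M[R]_(n, n * n)) : 'M[R]_(n, n * n) :=
  \matrix_(j, c) H (mxtens_unindex c).2
                   (mxtens_index ((mxtens_unindex c).1, j)).

Definition lyapunov (R : realType) n (A P M : 'M[R]_n) : Prop :=
  A *m P + P *m A^T + M = 0.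

Definition reach_source (R : realType) n m (H : 'M[R]_(n, n * n))
    (N : 'I_m -> 'M[R]_n) (B : 'M[R]_(n, m)) (P1 : 'M[R]_n) : 'M[R]_n :=
  H *m (P1 *t P1) *m H^T + \sum_k N k *m P1 *m (N k)^T + B *m B^T.

(* This is the matrix G of the stability radius. *)
Definition obs_source (R : realType) n m p (H : 'M[R]_(n, n * n))
    (N : 'I_m -> 'M[R]_n) (C : 'M[R]_(p, n)) (P1 Q1 : 'M[R]_n) : 'M[R]_n :=
  mode2 H *m (P1 *t Q1) *m (mode2 H)^T + \sum_k (N k)^T *m Q1 *m N k
  + C^T *m C.

(* Factors S of P and L of Q, and a full singular value decomposition
   S^T L = [U1 U2] diag(Sigma1, Sigma2) [V1 V2]^T with Sigma1 = diag_mx s1.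
   S and L may have any numbers nh + s and nh + q of columns; then Sigma2 is
   a rectangular diagonal matrix.  The factorizations make P and Q positive
   semidefinite. *)
Record square_root_svd (R : realType) n nh s q (P Q : 'M[R]_n)
    (S : 'M[R]_(n, nh + s)) (L : 'M[R]_(n, nh + q))
    (U1 : 'M[R]_(nh + s, nh)) (U2 : 'M[R]_(nh + s, s))
    (V1 : 'M[R]_(nh + q, nh)) (V2 : 'M[R]_(nh + q, q))
    (s1 : 'rV[R]_nh) (Sigma2 : 'M[R]_(s, q)) : Prop := SquareRootSvd {
  srs_P : P = S *m S^T;
  srs_Q : Q = L *m L^T;
  srs_svd : S^T *m L =
    row_mx U1 U2 *m block_mx (diag_mx s1) 0 0 Sigma2 *m (row_mx V1 V2)^T;
  srs_U : (row_mx U1 U2)^T *m row_mx U1 U2 = 1%:M;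
  srs_V : (row_mx V1 V2)^T *m row_mx V1 V2 = 1%:M;
  srs_s1_gt0 : forall i, 0 < s1 0 i;
  srs_Sigma2_diag : is_diag_mx Sigma2;
  srs_Sigma2_ge0 : forall i j, 0 <= Sigma2 i j;
  srs_largest : forall i j k, Sigma2 j k <= s1 0 i
}.

Definition diag_invsqrt (R : realType) n (s : 'rV[R]_n) : 'M[R]_n :=
  diag_mx (map_mx (fun a => (Num.sqrt a)^-1) s).

Definition qb_field (R : realType) n (A : 'M[R]_n) (H : 'M[R]_(n, n * n))
    (x : 'cV[R]_n) : 'cV[R]_n := A *m x + H *m (x *t x).

Definition quad_form (R : realType) n (M : 'M[R]_n) (x : 'cV[R]_n) : R :=
  (x^T *m M *m x) 0 0.

Definition is_solution (R : realType) n (f : 'cV[R]_n -> 'cV[R]_n)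
    (xi : R -> 'cV[R]_n) (a b : R) : Prop :=
  forall t, a < t < b -> is_derive t 1 xi (f (xi t)).

(* The derivative of F along the solutions of x' = f x is negative at x: the
   first two clauses say that the orbital derivative, i.e. the derivative of F
   at x in the direction f x, exists and is negative; the last one says the
   same of t |-> F (xi t) at each time when a solution xi is at x. *)
Definition decreasing_along (R : realType) n (f : 'cV[R]_n -> 'cV[R]_n)
    (F : 'cV[R]_n -> R) (x : 'cV[R]_n) : Prop :=
  [/\ derivable F x (f x), 'D_(f x) F x < 0 &
      forall (xi : R -> 'cV[R]_n) (a b t : R),
        is_solution f xi a b -> a < t < b -> xi t = x ->
        derivable (F \o xi) t 1 /\ derive1 (F \o xi) t < 0].

(* Main.v *)
(* The singular value decomposition gives Q_T V = W Sigma_1, hence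
   Sigma_1 W^T = V^T Q_T, and the Lyapunov equation of Q_T turns the linear part
   of the derivative of x^T Sigma_1 x into - x^T V^T G V x.  As V^T G V is
   positive semidefinite, this is at most - sigma_min(V^T G V) |x|^2, while the
   quadratic part is at most 2 ||Sigma_1|| ||Hh|| |x|^3, which is smaller in
   absolute value when |x| < r.

   Semidefiniteness of G reduces to that of P_1 and Q_1.  A stable A is
   similar, over the complex numbers, to some F with F + F^* negative definite
   (Schur form, then a diagonal scaling).  If F Y + Y F^* = - Z Z^*, then the
   skew part of Y vanishes, by taking a trace, and a unit eigenvector v of Y for
   the eigenvalue d satisfies d v (F + F^* ) v^* = - |v Z|^2, so d >= 0. *)
Require Import Defs.
From mathcomp Require Import all_boot all_order all_algebra spectral.
From mathcomp Require Import ring lra.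

Set Implicit Arguments.
Unset Strict Implicit.
Unset Printing Implicit Defensive.

Import Order.TTheory GRing.Theory Num.Theory.
Import numFieldNormedType.Exports.
Local Open Scope ring_scope.

(** * Lyapunov equations over a closed numeric field *)

Section ComplexLyapunov.
Local Open Scope sesquilinear_scope.
Variable C : numClosedFieldType.

Lemma adjmxM m n p (A : 'M[C]_(m, n)) (B : 'M[C]_(n, p)) :
  (A *m B)^t* = B^t* *m A^t*.
Proof. by rewrite trmx_mul map_mxM. Qed.

Lemma adjmxD m n (A B : 'M[C]_(m, n)) : (A + B)^t* = A^t* + B^t*.
Proof. by rewrite linearD map_mxD. Qed.

Lemma adjmxZ m n a (A : 'M[C]_(m, n)) : (a *: A)^t* = a^* *: A^t*.
Proof. by apply/matrixP => i j; rewrite !mxE rmorphM. Qed.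

Lemma mulmx_adj_diag m n (Z : 'M[C]_(m, n)) i :
  (Z *m Z^t* ) i i = \sum_j `|Z i j| ^+ 2.
Proof. by rewrite mxE; apply: eq_bigr => j _; rewrite !mxE normCK. Qed.

Lemma mulmx_adj_diag_ge0 m n (Z : 'M[C]_(m, n)) i : 0 <= (Z *m Z^t* ) i i.
Proof.
by rewrite mulmx_adj_diag; apply: sumr_ge0 => j _; rewrite exprn_ge0.
Qed.

(** Row vectors match the left eigenvectors of [eigenvalue]; an element of [C] below zero is
    automatically real. *)
Definition neg_def n (M : 'M[C]_n) :=
  forall v : 'rV_n, v != 0 -> (v *m M *m v^t* ) 0 0 < 0.

(** Bounding each cross term with [|v_i| |v_j| <= |v_i|^2 + |v_j|^2] and using [|M i j| = |M j i|]
    charges row [i] with twice its off-diagonal sum, whence the factor 2 in the hypothesis. *)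
Lemma diag_dominant_neg_def n (M : 'M[C]_n) : M^t* = M ->
  (forall i, M i i + \sum_(j | j != i) `|M i j| *+ 2 < 0) -> neg_def M.
Proof.
move=> Mh dom v v0.
have Mij i j : M i j = (M j i)^* by rewrite -{1}Mh !mxE.
set w := (v *m M *m v^t* ) 0 0.
have wE : w = \sum_i M i i * `|v 0 i| ^+ 2 +
    \sum_i \sum_(j | j != i) v 0 i * M i j * (v 0 j)^*.
  rewrite /w !mxE -big_split/=.
  transitivity (\sum_j \sum_i v 0 i * M i j * (v 0 j)^*).
    by apply: eq_bigr => j _; rewrite !mxE big_distrl.
  rewrite exchange_big/=; apply: eq_bigr => i _.
  by rewrite (bigD1 i)//= normCK; congr (_ + _); ring.
set off := (X in _ + X) in wE.
have Mr i : M i i \is Num.real by apply/CrealP; rewrite -Mij.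
have wr : w \is Num.real.
  apply/CrealP; rewrite /w.
  have -> : ((v *m M *m v^t* ) 0 0)^* = ((v *m M *m v^t* )^t* ) 0 0 by rewrite !mxE.
  by rewrite !adjmxM trmxCK Mh mulmxA.
have dr : \sum_i M i i * `|v 0 i| ^+ 2 \is Num.real.
  by apply: rpred_sum => i _; rewrite rpredM// rpredX// normr_real.
(* The order on [C] is partial: [off] must be real before it can be bounded by its norm. *)
have offr : off \is Num.real by rewrite (_ : off = w - \sum_i M i i * `|v 0 i| ^+ 2) ?rpredB// wE; ring.
have offle : off <= \sum_i \sum_(j | j != i) `|M i j| * (`|v 0 i| ^+ 2 + `|v 0 j| ^+ 2).
  apply: le_trans (real_ler_norm offr) _.
  apply: le_trans (ler_norm_sum _ _ _) _; apply: ler_sum => i _.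
  apply: le_trans (ler_norm_sum _ _ _) _; apply: ler_sum => j _.
  rewrite !normrM norm_conjC mulrAC mulrC ler_wpM2l//.
  have: 0 <= (`|v 0 i| - `|v 0 j|) ^+ 2 by rewrite real_exprn_even_ge0// rpredB ?normr_real.
  have : 0 <= `|v 0 i| * `|v 0 j| by rewrite mulr_ge0.
  rewrite sqrrB => h1 h2; rewrite -subr_ge0.
  suff -> : `|v 0 i| ^+ 2 + `|v 0 j| ^+ 2 - `|v 0 i| * `|v 0 j| =
    (`|v 0 i| ^+ 2 - `|v 0 i| * `|v 0 j| *+ 2 + `|v 0 j| ^+ 2) + `|v 0 i| * `|v 0 j|.
    by rewrite addr_ge0.
  ring.
have symE : \sum_i \sum_(j | j != i) `|M i j| * (`|v 0 i| ^+ 2 + `|v 0 j| ^+ 2) =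
    \sum_i (\sum_(j | j != i) `|M i j| *+ 2) * `|v 0 i| ^+ 2.
  transitivity (\sum_i \sum_(j | j != i) `|M i j| * `|v 0 i| ^+ 2 +
     \sum_i \sum_(j | j != i) `|M i j| * `|v 0 j| ^+ 2).
    rewrite -big_split/=; apply: eq_bigr => i _.
    by rewrite -big_split/=; apply: eq_bigr => j _; rewrite mulrDr.
  rewrite [X in _ + X](exchange_big_dep predT)//= -big_split/=.
  apply: eq_bigr => i _; rewrite big_distrl/=.
  under [X in _ + X]eq_bigl do rewrite eq_sym.
  rewrite -big_split/=; apply: eq_bigr => j _.
  by rewrite (Mij j i) norm_conjC -mulrDl.
apply: (@le_lt_trans _ _ (\sum_i (M i i + \sum_(j | j != i) `|M i j| *+ 2) * `|v 0 i| ^+ 2)).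
  rewrite wE; under [leRHS]eq_bigr do rewrite mulrDl.
  by rewrite big_split/= lerD2l -symE.
have [i vi] : exists i, v 0 i != 0 by apply/rV0Pn.
rewrite (bigD1 i)//= -[ltRHS]addr0 ltr_leD//.
  by rewrite nmulr_rlt0// exprn_gt0// normr_gt0.
by apply: sumr_le0 => j _; rewrite nmulr_rle0// exprn_ge0.
Qed.

(* Conjugating by [diag(e^i)] shrinks the off-diagonal part of a lower
   triangular matrix without changing its diagonal. *)
Lemma trig_dissipative n (T : 'M[C]_n) : is_trig_mx T ->
  (forall i, T i i + (T i i)^* < 0) ->
  exists2 K, K \in unitmx &
    neg_def (K *m T *m invmx K + (K *m T *m invmx K)^t* ).
Proof.
move=> /is_trig_mxP trigT Tneg.
pose a i := - (T i i + (T i i)^*).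
pose c i := \sum_j (`|T i j| + `|T j i|) *+ 2.
have a0 i : 0 < a i by rewrite oppr_gt0.
have c0 i : 0 <= c i by apply: sumr_ge0 => j _; rewrite mulrn_wge0// addr_ge0.
(* One scale serves all rows: the sum of the ratios dominates each of them, which gives
   [e * c i < a i], and the summand 1 makes this strict and keeps [e <= 1]. *)
pose e := (1 + \sum_i c i / a i)^-1.
have s0 : 0 <= \sum_i c i / a i by apply: sumr_ge0 => j _; rewrite divr_ge0// ltW.
have s1 : 0 < 1 + \sum_i c i / a i by rewrite ltr_pwDl.
have e0 : 0 < e by rewrite invr_gt0.
have e1 : e <= 1 by rewrite invf_le1// lerDl.
have ec i : e * c i < a i.
  rewrite mulrC ltr_pdivrMr// mulrDr mulr1 (bigD1 i)//= mulrDr [a i * (c i / _)]mulrC divfK ?gt_eqF//.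
  rewrite -subr_gt0 [X in 0 < X](_ : _ = a i + a i * (\sum_(j | j != i) c j / a j)); last by ring.
  rewrite ltr_pwDl// mulr_ge0 ?(ltW (a0 i))//; apply: sumr_ge0 => j _.
  by rewrite divr_ge0// ltW.
pose d := \row_(i < n) e ^+ i; pose d' := \row_(i < n) e ^- i.
have dd' : diag_mx d *m diag_mx d' = 1%:M.
  rewrite mulmx_diag -diag_const_mx; congr diag_mx.
  by apply/rowP => i; rewrite !mxE divff// expf_eq0 gt_eqF// andbF.
have uK : diag_mx d \in unitmx by have [] := mulmx1_unit dd'.
exists (diag_mx d) => //.
have -> : invmx (diag_mx d) = diag_mx d'.
  by rewrite -[RHS](mulKmx uK) dd' mulmx1.
set F := _ *m _ *m _.
have FE i j : F i j = e ^+ i * T i j * e ^- j.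
  by rewrite /F mul_mx_diag mxE mul_diag_mx !mxE.
have Fii i : F i i = T i i.
  by rewrite FE mulrAC mulfV ?mul1r// expf_eq0 gt_eqF// andbF.
have Fij i j : i != j -> `|F i j| <= e * `|T i j|.
  move=> ij; have [lt_ij|le_ji] := ltnP i j.
    by rewrite FE trigT// mulr0 mul0r !normr0 mulr0.
  have lt_ji : (j < i)%N by rewrite ltn_neqAle le_ji andbT eq_sym.
  rewrite FE mulrAC normrM ler_wpM2r// -expfB// ger0_norm ?exprn_ge0 ?(ltW e0)//.
  (* Below the diagonal the exponent [i - j] is at least 1, so [e <= 1] gives
     [e ^+ (i - j) <= e]. *)
  rewrite -[leRHS]expr1 -(@subnK 1 (i - j)) ?subn_gt0// exprD ler_piMl ?expr1 ?(ltW e0)//.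
  by rewrite exprn_ile1// (ltW e0).
clearbody F; apply: diag_dominant_neg_def; first by rewrite adjmxD trmxCK addrC.
move=> i; rewrite !mxE Fii -[T i i + _]opprK -/(a i) addrC subr_lt0.
apply: le_lt_trans (ec i); rewrite mulr_sumr.
(* The term [j = i] of [c i] is nonnegative and is discarded. *)
rewrite [leRHS](bigD1 i)//= -[leLHS]add0r lerD//.
  by rewrite mulr_ge0 ?(ltW e0)// mulrn_wge0// addr_ge0.
apply: ler_sum => j ji; rewrite !mxE mulrnAr lerMn2r/=.
rewrite (le_trans (ler_normD _ _))// norm_conjC mulrDr lerD// Fij//.
by rewrite eq_sym.
Qed.

(** Since [a + a^*] is twice the real part of [a], the hypothesis is stability. The Schur form puts
    the eigenvalues on the diagonal of a triangular matrix, where [trig_dissipative] applies. *)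
Lemma stable_dissipative n (A : 'M[C]_n) :
  (forall a, eigenvalue A a -> a + a^* < 0) ->
  exists2 K, K \in unitmx &
    neg_def (K *m A *m invmx K + (K *m A *m invmx K)^t* ).
Proof.
case: n A => [|n] A sA.
  (* In dimension zero, which [Schur] excludes, there is no nonzero row vector. *)
  by exists 1%:M; rewrite ?unitmx1// => v; rewrite thinmx0 eqxx.
have [U Uu] := Schur A (ltn0Sn n).
have Uun := unitarymx_unit Uu.
rewrite /similar_to/= conjumx// => Ttrig.
set T := U *m A *m invmx U in Ttrig.
have Tneg i : T i i + (T i i)^* < 0.
  apply: sA; have : eigenvalue T (T i i).
    rewrite eigenvalue_root_char char_poly_trig//.
    by rewrite (bigD1 i)//= rootM root_XsubC eqxx.
  case/eigenvalueP => v vT v0; apply/eigenvalueP; exists (v *m U).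
    rewrite scalemxAl -vT /T !mulmxA mulmxKV//.
  by rewrite mulmx_free_eq0 ?row_free_unit.
have [K Kun KT] := trig_dissipative Ttrig Tneg.
exists (K *m U); first by rewrite unitmx_mul Kun.
have -> : K *m U *m A *m invmx (K *m U) = K *m T *m invmx K; last by [].
have -> : invmx (K *m U) = invmx U *m invmx K.
  have uKU : K *m U \in unitmx by rewrite unitmx_mul Kun.
  have KU1 : K *m U *m (invmx U *m invmx K) = 1%:M.
    by rewrite mulmxA mulmxK ?mulmxV.
  by rewrite -[RHS](mulKmx uKU) KU1 mulmx1.
by rewrite /T !mulmxA.
Qed.

Lemma adjmx_inj m n : injective (fun A : 'M[C]_(m, n) => A^t* ).
Proof. by move=> A B /(congr1 (fun X => X^t* )); rewrite !trmxCK. Qed.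

(** With [U] on the left, the rows of [U] are orthonormal left eigenvectors of [M]. *)
Lemma hermitian_spectral n (M : 'M[C]_n) : M^t* = M ->
  exists U (d : 'rV[C]_n), [/\ U *m U^t* = 1%:M, U^t* *m U = 1%:M,
    U *m M = diag_mx d *m U & forall i, d 0 i \is Num.real].
Proof.
move=> Mh; have hM : M \is hermsymmx.
  by apply/is_hermitianmxP; rewrite expr0 scale1r Mh.
have Uu := spectral_unitarymx M; have Uun := spectral_unit M.
exists (spectralmx M), (spectral_diag M); split.
- exact/unitarymxP.
- exact/mulmx1C/unitarymxP.
- have /orthomx_spectralP eM := hermitian_normalmx hM.
  by rewrite [X in _ *m X = _]eM !mulmxA mulmxV// mul1mx.
- by move=> i; have /mxOverP := hermitian_spectral_diag_real hM; apply.
Qed.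

(** As [W] is skew, cyclicity of the trace and the equation give [W *m (F + F^t* ) *m W^t*] trace
    zero. Its diagonal entries are values of a negative definite form at the rows of [W], so every
    row vanishes. *)
Lemma neg_def_lyapunov_skew_eq0 n (F W : 'M[C]_n) :
  neg_def (F + F^t* ) -> W^t* = - W -> F *m W + W *m F^t* = 0 -> W = 0.
Proof.
move=> Fneg Wsk eqW; apply/row_matrixP => i; rewrite row0; apply/eqP.
apply: contraT => Wi0.
have tr0 : \tr (W *m (F + F^t* ) *m W^t* ) = 0.
  rewrite Wsk mulmxN mulmxDr mulmxDl raddfN/= raddfD/=.
  rewrite -[W *m F *m W]mulmxA mxtrace_mulC -raddfD/=.
  by rewrite -mulmxDl eqW mul0mx raddf0 oppr0.
have rowE k : (W *m (F + F^t* ) *m W^t* ) k k =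
    (row k W *m (F + F^t* ) *m (row k W)^t* ) 0 0.
  rewrite -row_mul !mxE; apply: eq_bigr => j _; congr (_ * _).
    by rewrite [RHS]mxE.
  by rewrite !mxE.
have le0 k : (W *m (F + F^t* ) *m W^t* ) k k <= 0.
  rewrite rowE; have [->|/Fneg/ltW//] := eqVneq (row k W) 0.
  by rewrite !mul0mx mxE.
have: \tr (W *m (F + F^t* ) *m W^t* ) < 0.
  rewrite /mxtrace (bigD1 i)//= -[ltRHS]addr0 ltr_leD//; last exact: sumr_le0.
  by rewrite rowE Fneg.
by rewrite tr0 ltxx.
Qed.

Lemma neg_def_lyapunov_gram n k (F Y : 'M[C]_n) (Z : 'M[C]_(n, k)) :
  neg_def (F + F^t* ) -> F *m Y + Y *m F^t* + Z *m Z^t* = 0 ->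
  exists Z' : 'M[C]_n, Y = Z' *m Z'^t*.
Proof.
move=> Fneg eqY.
have Yh : Y^t* = Y.
  apply/esym/eqP; rewrite -subr_eq0; apply/eqP.
  apply: (@neg_def_lyapunov_skew_eq0 _ F) => //.
    by rewrite adjmxD linearN map_mxN trmxCK opprB addrC.
  (* The adjoint of the equation is the same equation for [Y^t*]; subtracting the two cancels
     [Z *m Z^t*]. *)
  have eqY' := congr1 (fun X => X^t* ) eqY.
  rewrite !adjmxD !adjmxM !trmxCK trmx0 map_mx0 in eqY'.
  rewrite mulmxBr mulmxBl.
  transitivity (F *m Y + Y *m F^t* + Z *m Z^t* -
                (Y^t* *m F^t* + F *m Y^t* + Z *m Z^t* )).
    rewrite [in RHS]opprD [RHS]addrACA subrr addr0.
    by rewrite [Y^t* *m _ + _]addrC opprD [RHS]addrACA.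
  by rewrite eqY eqY' subr0.
have [U [d [UU UU' UY dr]]] := hermitian_spectral Yh.
have d0 i : 0 <= d 0 i.
  set u := row i U.
  have u0 : u != 0.
    apply: contra_eq_neq (congr1 (fun X : 'M[C]_n => X i i) UU) => u0.
    rewrite mulmx_adj_diag big1 ?mxE ?eqxx 1?eq_sym ?oner_neq0// => j _.
    by have := congr1 (fun X : 'rV[C]_n => X 0 j) u0; rewrite !mxE => ->; rewrite normr0 expr0n.
  have uY : u *m Y = d 0 i *: u.
    by rewrite /u -row_mul UY row_mul row_diag_mx -scalemxAl -rowE.
  have Yu : Y *m u^t* = d 0 i *: u^t*.
    by apply: adjmx_inj; rewrite adjmxM trmxCK Yh uY adjmxZ trmxCK (CrealP (dr i)).
  have := congr1 (fun X => (u *m X *m u^t* ) 0 0) eqY.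
  rewrite /= !mulmxDr !mulmxDl mulmx0 mul0mx [RHS]mxE.
  rewrite !mulmxA -[u *m F *m Y *m _]mulmxA Yu uY -scalemxAr -!scalemxAl -scalerDr.
  rewrite -mulmxDl -mulmxDr mxE [X in X + _]mxE => /eqP; rewrite addr_eq0 => /eqP eqd.
  rewrite -(nmulr_lle0 _ (Fneg u u0)) eqd oppr_le0.
  by rewrite -mulmxA -adjmxM mulmx_adj_diag_ge0.
(* The square roots of the nonnegative eigenvalues are self-conjugate, so this factor reproduces the
   spectral decomposition of [Y]. *)
exists (U^t* *m diag_mx (map_mx sqrtC d)).
rewrite adjmxM trmxCK tr_diag_mx map_diag_mx mulmxA -[_ *m diag_mx _ *m diag_mx _]mulmxA mulmx_diag.
rewrite -[LHS]mul1mx -UU' -mulmxA UY mulmxA; congr (_ *m diag_mx _ *m _).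
apply/rowP => i; rewrite !mxE.
have /geC0_conj cj : 0 <= sqrtC (d 0 i) by rewrite sqrtC_ge0.
by rewrite [X in _ * X]cj -expr2 sqrtCK.
Qed.

(** Conjugating [A] by [K] yields the Lyapunov equation of [K *m P *m K^t*] with source factor
    [K *m Z]; the Gram factor found there is pulled back by [invmx K]. *)
Lemma stable_lyapunov_gram n k (A P : 'M[C]_n) (Z : 'M[C]_(n, k)) :
  (forall a, eigenvalue A a -> a + a^* < 0) ->
  A *m P + P *m A^t* + Z *m Z^t* = 0 ->
  exists Z' : 'M[C]_n, P = Z' *m Z'^t*.
Proof.
move=> sA eqP; have [K Ku Kneg] := stable_dissipative sA.
have KK : (invmx K)^t* = invmx (K^t* ) by rewrite trmx_inv map_invmx.
have Ku' : K^t* \in unitmx by rewrite map_unitmx unitmx_tr.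
have [|Z' eZ] := @neg_def_lyapunov_gram _ _ _ (K *m P *m K^t* ) (K *m Z) Kneg.
  rewrite !adjmxM KK !mulmxA mulmxKV// [X in _ + X + _](_ : _ = K *m (P *m A^t* ) *m K^t* ).
    rewrite -[K *m A *m P]mulmxA -[K *m Z *m _]mulmxA -!mulmxDl -!mulmxDr.
    by rewrite eqP mulmx0 mul0mx.
  by rewrite !mulmxA mulmxK.
exists (invmx K *m Z'); rewrite adjmxM KK mulmxA -[_ *m Z' *m _]mulmxA -eZ.
by rewrite !mulmxA mulVmx// mul1mx mulmxK.
Qed.

End ComplexLyapunov.

(** * Euclidean and spectral norms *)

Section EuclideanNorm.
Variable R : realType.

Lemma enorm_ge0 n (x : 'cV[R]_n) : 0 <= enorm x.
Proof. exact: sqrtr_ge0. Qed.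

Lemma enorm_sqr n (x : 'cV[R]_n) : enorm x ^+ 2 = \sum_i x i 0 ^+ 2.
Proof. by rewrite sqr_sqrtr//; apply: sumr_ge0 => i _; rewrite sqr_ge0. Qed.

(** Lagrange's identity; the factor 2 appears because the sum of squares runs over ordered pairs. *)
Lemma cauchy_schwarz_sum (I : finType) (a b : I -> R) :
  (\sum_i a i * b i) ^+ 2 <= (\sum_i a i ^+ 2) * (\sum_i b i ^+ 2).
Proof.
rewrite -subr_ge0 -(pmulr_rge0 _ (ltr0Sn R 1)).
suff -> : 2 * ((\sum_i a i ^+ 2) * (\sum_i b i ^+ 2) - (\sum_i a i * b i) ^+ 2)
    = \sum_i \sum_j (a i * b j - a j * b i) ^+ 2.
  by apply: sumr_ge0 => i _; apply: sumr_ge0 => j _; rewrite sqr_ge0.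
rewrite mulrBr mulr_natl mulr2n {2}[_ * \sum_i b i ^+ 2]mulrC expr2 !big_distrlr/=.
rewrite mulr_sumr -big_split/= -sumrB; apply: eq_bigr => i _.
rewrite mulr_sumr -big_split/= -sumrB; apply: eq_bigr => j _.
ring.
Qed.

Lemma dot_le_enorm n (x y : 'cV[R]_n) : (x^T *m y) 0 0 <= enorm x * enorm y.
Proof.
apply: le_trans (ler_norm _) _.
rewrite -(ler_pXn2r (ltn0Sn 1)) ?nnegrE ?mulr_ge0 ?enorm_ge0//.
rewrite real_normK ?num_real// exprMn !enorm_sqr.
apply: le_trans (cauchy_schwarz_sum _ _).
by rewrite mxE; under eq_bigr do rewrite mxE.
Qed.

Lemma enormZ n a (x : 'cV[R]_n) : enorm (a *: x) = `|a| * enorm x.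
Proof.
rewrite /enorm -sqrtr_sqr -sqrtrM ?sqr_ge0// mulr_sumr; congr Num.sqrt.
by apply: eq_bigr => i _; rewrite mxE exprMn.
Qed.

Lemma enorm_gt0 n (x : 'cV[R]_n) : x != 0 -> 0 < enorm x.
Proof.
case/cV0Pn => i xi; rewrite sqrtr_gt0 (bigD1 i)//= ltr_pwDl//.
  by rewrite exprn_even_gt0.
by apply: sumr_ge0 => j _; rewrite sqr_ge0.
Qed.

Lemma enorm0 n : enorm (0 : 'cV[R]_n) = 0.
Proof. by rewrite -(scale0r (0 : 'cV[R]_n)) enormZ normr0 mul0r. Qed.

(** The Frobenius norm supplies the upper bound that makes the [sup] in [spectral_norm]
    meaningful. *)
Lemma enorm_mulmx_frobenius m n (M : 'M[R]_(m, n)) (x : 'cV[R]_n) :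
  enorm (M *m x) <= Num.sqrt (\sum_i \sum_j M i j ^+ 2) * enorm x.
Proof.
rewrite /enorm -sqrtrM; last first.
  by apply: sumr_ge0 => i _; apply: sumr_ge0 => j _; rewrite sqr_ge0.
rewrite ler_wsqrtr// mulr_suml; apply: ler_sum => i _.
by rewrite mxE cauchy_schwarz_sum.
Qed.

Lemma enorm_mulmx m n (M : 'M[R]_(m, n)) (x : 'cV[R]_n) :
  enorm (M *m x) <= spectral_norm M * enorm x.
Proof.
have [->|/enorm_gt0 x0] := eqVneq x 0; first by rewrite mulmx0 !enorm0 mulr0.
rewrite -ler_pdivrMr// mulrC -[X in X * _]ger0_norm ?invr_ge0 ?enorm_ge0//.
rewrite -enormZ scalemxAr; apply: ub_le_sup.
  exists (Num.sqrt (\sum_i \sum_j M i j ^+ 2)) => _ [y /= y1 <-].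
  by rewrite (le_trans (enorm_mulmx_frobenius _ _))// ler_piMr// sqrtr_ge0.
exists ((enorm x)^-1 *: x) => //=.
by rewrite enormZ ger0_norm ?invr_ge0 ?enorm_ge0// mulVf// gt_eqF.
Qed.

Lemma spectral_norm_ge0 m n (M : 'M[R]_(m, n)) : 0 <= spectral_norm M.
Proof.
apply: ub_le_sup; last by exists 0; rewrite /= ?mulmx0 enorm0.
exists (Num.sqrt (\sum_i \sum_j M i j ^+ 2)) => _ [y /= y1 <-].
by rewrite (le_trans (enorm_mulmx_frobenius _ _))// ler_piMr// sqrtr_ge0.
Qed.

(** With [y = x] this makes the quadratic term of the vector field of order [enorm x ^+ 2]. *)
Lemma enorm_tens m n (x : 'cV[R]_m) (y : 'cV[R]_n) :
  enorm (x *t y) = enorm x * enorm y.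
Proof.
rewrite /enorm -sqrtrM; last by apply: sumr_ge0 => i _; rewrite sqr_ge0.
congr Num.sqrt; rewrite big_distrlr/= pair_big/=.
rewrite (reindex (@mxtens_index m n)); last first.
  by exists (@mxtens_unindex m n) => i _; rewrite ?mxtens_indexK ?mxtens_unindexK.
apply: eq_bigr => -[i j] _; rewrite mxE mxtens_indexK/= !ord1 exprMn.
by congr (x _ _ ^+ 2 * y _ _ ^+ 2); apply: ord_inj; rewrite ?ord1.
Qed.

End EuclideanNorm.

(** * Positive semidefinite real matrices *)

Section PositiveSemidefinite.
Local Open Scope sesquilinear_scope.
Variable R : realType.
Local Notation toC := (real_complex R).
Local Notation C := (R[i]).

Lemma adjmx_real m n (M : 'M[R]_(m, n)) : (map_mx toC M)^t* = map_mx toC M^T.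
Proof. by apply/matrixP => i j; rewrite !mxE; exact: conjc_real. Qed.

(* Factoring over [R[i]] rather than [R] lets the complex spectral theorem
   provide the factors. *)
Definition psdmx n (M : 'M[R]_n) :=
  exists k (Z : 'M[C]_(n, k)), map_mx toC M = Z *m Z^t*.

Lemma psdmx_gram m n (X : 'M[R]_(m, n)) : psdmx (X *m X^T).
Proof. by exists n, (map_mx toC X); rewrite adjmx_real map_mxM. Qed.

Lemma psdmx0 n : psdmx (0 : 'M[R]_n).
Proof. by have := psdmx_gram (0 : 'M[R]_n); rewrite mul0mx. Qed.

(** Placing two factors side by side adds their Gram matrices. *)
Lemma psdmxD n (M N : 'M[R]_n) : psdmx M -> psdmx N -> psdmx (M + N).
Proof.
move=> [k [Z eM]] [l [Y eN]]; exists (k + l)%N, (row_mx Z Y).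
by rewrite map_mxD eM eN tr_row_mx map_col_mx mul_row_col.
Qed.

Lemma psdmx_sum n I (r : seq I) (M : I -> 'M[R]_n) :
  (forall i, psdmx (M i)) -> psdmx (\sum_(i <- r) M i).
Proof.
move=> psdM; elim/big_ind: _ => //; first exact: psdmx0.
exact: psdmxD.
Qed.

Lemma psdmx_congr m n (X : 'M[R]_(m, n)) (M : 'M[R]_n) :
  psdmx M -> psdmx (X *m M *m X^T).
Proof.
move=> [k [Z eM]]; exists k, (map_mx toC X *m Z).
by rewrite adjmxM adjmx_real !map_mxM eM !mulmxA.
Qed.

(** By the mixed product rule the Kronecker product of the factors is a factor. *)
Lemma psdmx_tens m n (M : 'M[R]_m) (N : 'M[R]_n) :
  psdmx M -> psdmx N -> psdmx (M *t N).
Proof.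
move=> [k [Z eM]] [l [Y eN]]; exists (k * l)%N, (Z *t Y).
by rewrite trmx_tens !map_mxT eM eN tensmx_mul.
Qed.

Lemma stable_trmx n (A : 'M[R]_n) : stable A -> stable A^T.
Proof.
move=> sA z; rewrite -map_trmx => Az; apply: sA.
move: Az; rewrite !eigenvalue_root_char /char_poly /char_poly_mx.
by rewrite -det_tr linearB/= tr_scalar_mx -map_trmx trmxK.
Qed.

(** Covers [P1] directly, and [Q1] with [A^T] and [C^T] in place of [A] and [B]. *)
Lemma stable_lyapunov_psd m n (A P : 'M[R]_n) (B : 'M[R]_(n, m)) :
  stable A -> lyapunov A P (B *m B^T) -> psdmx P.
Proof.
move=> sA eqP.
have [|//|Z eP] := @stable_lyapunov_gram _ _ _ (map_mx toC A) (map_mx toC P) (map_mx toC B).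
- move=> a /sA a0; rewrite [_ + _](addcJ a) pmulr_rlt0 ?ltr0n//.
  by rewrite -[0]/(toC 0) ltcR.
- by rewrite !adjmx_real -!map_mxM -!map_mxD eqP map_mx0.
- by exists n, Z.
Qed.

Lemma psdmx_sym n (M : 'M[R]_n) : psdmx M -> M^T = M.
Proof.
move=> [k [Z eM]]; apply: (map_mx_inj (f := toC)).
by rewrite -adjmx_real eM adjmxM trmxCK.
Qed.

(** The eigenvalues of a positive semidefinite [M] are nonnegative and their squares are eigenvalues
    of [M^T *m M], so they are singular values, bounded below by [sigma_min M]. Expanding [x] in an
    eigenbasis concludes. *)
Lemma psdmx_rayleigh n (M : 'M[R]_n) (x : 'cV[R]_n) :
  psdmx M -> sigma_min M * enorm x ^+ 2 <= quad_form M x.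
Proof.
move=> psdM; have [k [Z eM]] := psdM.
have MT := psdmx_sym psdM.
have [|U [d [UU UU' UM _]]] := @hermitian_spectral _ _ (map_mx toC M).
  by rewrite adjmx_real MT.
have rowU i : row i U *m map_mx toC M = d 0 i *: row i U.
  by rewrite -row_mul UM row_mul row_diag_mx -scalemxAl -rowE.
have uu i : row i U *m (row i U)^t* = 1%:M.
  apply/rowP => j; rewrite !ord1 [RHS]mxE eqxx.
  transitivity ((U *m U^t* ) i i); last by rewrite UU mxE eqxx.
  by rewrite !mxE; apply: eq_bigr => l _; rewrite !mxE.
have d0 i : 0 <= d 0 i.
  have -> : d 0 i = ((row i U *m Z) *m (row i U *m Z)^t* ) 0 0.
    rewrite adjmxM mulmxA -[row i U *m Z *m _]mulmxA -eM rowU -scalemxAl uu.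
    by rewrite !mxE eqxx mulr1.
  exact: mulmx_adj_diag_ge0.
pose e i := complex.Re (d 0 i).
have dE i : d 0 i = toC (e i) by rewrite /e RRe_real// realE d0.
have e0 i : 0 <= e i by have := d0 i; rewrite dE ler0c.
have le_e i : sigma_min M <= e i.
  apply: ge_inf; first by exists 0 => s [].
  split=> //.
  (* The eigenvector is complex but the eigenvalue is real: the characteristic polynomial carries
     the claim from [R[i]] down to [R]. *)
  rewrite eigenvalue_root_char -(fmorph_root toC) map_char_poly.
  rewrite -eigenvalue_root_char; apply/eigenvalueP; exists (row i U).
    by rewrite map_mxM MT mulmxA rowU -scalemxAl rowU scalerA dE -expr2 rmorphXn.
  apply/eqP => u0; have := uu i; rewrite u0 mul0mx => /matrixP/(_ 0 0).
  by rewrite !mxE eqxx => /eqP; rewrite eq_sym oner_eq0.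
pose y := U *m map_mx toC x.
have eq1 : toC (quad_form M x) = \sum_i d 0 i * `|y i 0| ^+ 2.
  have -> : toC (quad_form M x) =
      ((map_mx toC x)^t* *m (map_mx toC M) *m map_mx toC x) 0 0.
    by rewrite adjmx_real -!map_mxM mxE.
  rewrite -[map_mx toC M]mul1mx -UU' -[U^t* *m _ *m _]mulmxA UM.
  rewrite !mulmxA -adjmxM -[_ *m U *m _]mulmxA mxE.
  apply: eq_bigr => i _; rewrite mul_mx_diag !mxE normCK -/y.
  by rewrite mulrAC mulrC; congr (_ * _); rewrite mulrC.
have eq2 : toC (enorm x ^+ 2) = \sum_i `|y i 0| ^+ 2.
  have -> : toC (enorm x ^+ 2) = ((map_mx toC x)^t* *m map_mx toC x) 0 0.
    rewrite adjmx_real -map_mxM mxE enorm_sqr; congr toC; rewrite mxE.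
    by apply: eq_bigr => i _; rewrite mxE.
  have -> : (map_mx toC x)^t* *m map_mx toC x = y^t* *m y.
    by rewrite /y adjmxM mulmxA -[_ *m U^t* *m U]mulmxA UU' mulmx1.
  by rewrite mxE; apply: eq_bigr => i _; rewrite !mxE normCK mulrC.
rewrite -lecR rmorphM/= eq1 eq2 mulr_sumr; apply: ler_sum => i _.
by rewrite ler_wpM2r ?exprn_ge0// dE lecR.
Qed.

Lemma obs_source_psd n m p (H : 'M[R]_(n, n * n))
    (N : 'I_m -> 'M[R]_n) (C : 'M[R]_(p, n)) (P1 Q1 : 'M[R]_n) :
  psdmx P1 -> psdmx Q1 -> psdmx (obs_source H N C P1 Q1).
Proof.
move=> psdP psdQ; apply: psdmxD; first apply: psdmxD.
- exact/psdmx_congr/psdmx_tens.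
- apply: psdmx_sum => k; rewrite -[X in _ *m X](trmxK (N k)).
  exact: psdmx_congr.
- by rewrite -[X in _ *m X](trmxK C); exact: psdmx_gram.
Qed.

End PositiveSemidefinite.

(** * Derivatives of diagonal quadratic forms *)

Section OrbitalDerivative.
Variable R : realType.

(** The general domain [V] serves two cases: [g] the identity, for the orbital derivative, and [g] a
    solution curve, for the derivative in time. *)
Lemma is_derive_quad_form_diag (V : normedModType R) n (s : 'rV[R]_n)
    (g : V -> 'cV[R]_n) (x v : V) (dg : 'cV[R]_n) :
  is_derive x v g dg ->
  is_derive x v (quad_form (diag_mx s) \o g)
    (2 * ((g x)^T *m diag_mx s *m dg) 0 0).
Proof.
move=> [dv De].
have dgi i : is_derive x v (fun y => g y i 0) (dg i 0).
  apply: DeriveDef; first by move/derivable_mxP : dv.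
  by rewrite -De derive_mx// mxE.
(* As a combination of squared coordinates, the function is differentiated by instance
   resolution. *)
have -> : quad_form (diag_mx s) \o g = \sum_i s 0 i *: (fun y => g y i 0) ^+ 2.
  apply/funext => y; rewrite fct_sumE /quad_form /= mxE.
  apply: eq_bigr => i _; rewrite mul_mx_diag !mxE.
  by rewrite mulrAC -expr2 mulrC.
apply: is_derive_eq.
rewrite mxE mulr_sumr; apply: eq_bigr => i _; rewrite mul_mx_diag !mxE.
rewrite /GRing.scale/= expr1; ring.
Qed.

(** Both derivatives equal [2 * (x^T *m diag_mx s *m f x) 0 0], so one sign settles them. *)
Lemma decreasing_along_diag n (s : 'rV[R]_n) (f : 'cV[R]_n -> 'cV[R]_n) x :
  (x^T *m diag_mx s *m f x) 0 0 < 0 ->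
  decreasing_along f (quad_form (diag_mx s)) x.
Proof.
move=> neg; have neg2 : 2 * (x^T *m diag_mx s *m f x) 0 0 < 0.
  by rewrite pmulr_rlt0.
have [dF DF] := is_derive_quad_form_diag s (is_derive_id x (f x)).
split => //; first by move: DF => /= ->.
move=> xi a b t sol abt xit.
have [dG DG] := is_derive_quad_form_diag s (sol t abt).
by split => //; rewrite derive1E DG xit.
Qed.

End OrbitalDerivative.

(** * Balancing and the stability radius *)

(** Orthonormality of [[U1 U2]] in the transposed decomposition gives
    [L^T *m S *m U1 = V1 *m diag_mx s1]; the diagonal factors then commute. *)
Lemma square_root_svd_mulmx (R : realType) n nh s q (P Q : 'M[R]_n)
    (S : 'M[R]_(n, nh + s)) (L : 'M[R]_(n, nh + q))
    (U1 : 'M[R]_(nh + s, nh)) (U2 : 'M[R]_(nh + s, s))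
    (V1 : 'M[R]_(nh + q, nh)) (V2 : 'M[R]_(nh + q, q))
    (s1 : 'rV[R]_nh) (Sigma2 : 'M[R]_(s, q)) :
  square_root_svd P Q S L U1 U2 V1 V2 s1 Sigma2 ->
  Q *m (S *m U1 *m diag_invsqrt s1) = L *m V1 *m diag_invsqrt s1 *m diag_mx s1.
Proof.
case=> _ -> svd eU _ _ _ _ _.
have [U11 U21] : U1^T *m U1 = 1%:M /\ U2^T *m U1 = 0.
  move: eU; rewrite tr_row_mx mul_col_row scalar_mx_block.
  by case/eq_block_mx.
have LSU : L^T *m S *m U1 = V1 *m diag_mx s1.
  have -> : L^T *m S = (S^T *m L)^T by rewrite trmx_mul trmxK.
  rewrite svd !trmx_mul trmxK tr_block_mx tr_diag_mx !trmx0 -!mulmxA.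
  rewrite tr_row_mx [col_mx U1^T _ *m _]mul_col_mx U11 U21 mul_block_col mul_row_col.
  by rewrite !(mulmx1, mul0mx, mulmx0, addr0).
rewrite !mulmxA -[L *m L^T *m S]mulmxA -[L *m _ *m U1]mulmxA LSU.
rewrite mulmxA -!mulmxA; congr (L *m (V1 *m _)).
by rewrite diag_mxC.
Qed.

Theorem theorem5p6 (R : realType) (n m p nh s q : nat)
    (A : 'M[R]_n) (H : 'M[R]_(n, n * n)) (N : 'I_m -> 'M[R]_n)
    (B : 'M[R]_(n, m)) (C : 'M[R]_(p, n))
    (P1 Q1 PT QT : 'M[R]_n)
    (S : 'M[R]_(n, nh + s)) (L : 'M[R]_(n, nh + q))
    (U1 : 'M[R]_(nh + s, nh)) (U2 : 'M[R]_(nh + s, s))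
    (V1 : 'M[R]_(nh + q, nh)) (V2 : 'M[R]_(nh + q, q))
    (s1 : 'rV[R]_nh) (Sigma2 : 'M[R]_(s, q)) :
  stable A ->
  symmetric_hessian H ->
  lyapunov A P1 (B *m B^T) ->
  lyapunov A^T Q1 (C^T *m C) ->
  lyapunov A PT (reach_source H N B P1) ->
  lyapunov A^T QT (obs_source H N C P1 Q1) ->
  square_root_svd PT QT S L U1 U2 V1 V2 s1 Sigma2 ->
  let Sigma1 : 'M[R]_nh := diag_mx s1 in
  let V : 'M[R]_(n, nh) := S *m U1 *m diag_invsqrt s1 in
  let W : 'M[R]_(n, nh) := L *m V1 *m diag_invsqrt s1 in
  let Ah : 'M[R]_nh := W^T *m A *m V in
  let Hh : 'M[R]_(nh, nh * nh) := W^T *m H *m (V *t V) in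
  let G : 'M[R]_n := obs_source H N C P1 Q1 in
  let r : R := sigma_min (V^T *m G *m V)
               / (2 * spectral_norm Sigma1 * spectral_norm Hh) in
  Hh <> 0 ->
  forall x : 'cV[R]_nh, enorm x < r -> x <> 0 ->
    0 < quad_form Sigma1 x /\
    decreasing_along (qb_field Ah Hh) (quad_form Sigma1) x.
Proof.
move=> sA _ eqP1 eqQ1 _ eqQT svd Sigma1 V W Ah Hh G r _ x xr /eqP x0.
have psdG : psdmx (V^T *m G *m V).
  rewrite -[X in _ *m X](trmxK V); apply/psdmx_congr/obs_source_psd.
    exact: stable_lyapunov_psd eqP1.
  apply: (stable_lyapunov_psd (B := C^T) (stable_trmx sA)).
  by rewrite trmxK.
have QTT : QT^T = QT by rewrite (srs_Q svd) trmx_mul trmxK.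
have QV : QT *m V = W *m Sigma1 := square_root_svd_mulmx svd.
have SW : Sigma1 *m W^T = V^T *m QT.
  by rewrite -[Sigma1]tr_diag_mx -trmx_mul -QV trmx_mul QTT.
have x_gt0 := enorm_gt0 x0.
split.
  have [i xi] : exists i, x i 0 != 0 by apply/cV0Pn.
  have s_gt0 := srs_s1_gt0 svd.
  have -> : quad_form Sigma1 x = \sum_i s1 0 i * x i 0 ^+ 2.
    rewrite /quad_form mxE; apply: eq_bigr => j _.
    by rewrite mul_mx_diag !mxE mulrAC -expr2 mulrC.
  rewrite (bigD1 i)//= ltr_pwDl//.
    by rewrite mulr_gt0// exprn_even_gt0.
  by apply: sumr_ge0 => j _; rewrite mulr_ge0 ?sqr_ge0// ltW.
apply: decreasing_along_diag.
(* With [y = V *m x] the left side is twice [y^T *m QT *m A *m y], that is, the form of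
   [A^T *m QT + QT *m A] at [y], and this sum is [- G]. *)
have linE : (x^T *m Sigma1 *m (Ah *m x)) 0 0 *+ 2 =
    - quad_form (V^T *m G *m V) x.
  pose y := V *m x; pose c := y^T *m QT *m A *m y.
  have -> : x^T *m Sigma1 *m (Ah *m x) = c.
    by rewrite /Ah /c /y [(V *m x)^T]trmx_mul !mulmxA -[x^T *m _ *m _]mulmxA SW !mulmxA.
  have -> : quad_form (V^T *m G *m V) x = (y^T *m G *m y) 0 0.
    by rewrite /quad_form /y [(V *m x)^T]trmx_mul !mulmxA.
  clearbody y; have eqG : G = - (A^T *m QT + QT *m A).
    by apply/eqP; rewrite -addr_eq0 addrC -[X in QT *m X]trmxK; apply/eqP.
  (* The two halves are transposes of each other and of size one by one, hence equal. *)
  have cT : y^T *m A^T *m QT *m y = c^T.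
    by rewrite /c !trmx_mul trmxK QTT !mulmxA.
  rewrite eqG mulmxN mulNmx mulmxDr mulmxDl !mulmxA cT -/c.
  by rewrite !mxE opprK mulr2n.
have nonlin : (x^T *m Sigma1 *m (Hh *m (x *t x))) 0 0 <=
    spectral_norm Sigma1 * spectral_norm Hh * enorm x ^+ 3.
  have -> : x^T *m Sigma1 = (Sigma1 *m x)^T by rewrite trmx_mul tr_diag_mx.
  apply: le_trans (dot_le_enorm _ _) _.
  have := enorm_mulmx Hh (x *t x); rewrite enorm_tens -expr2 => leH.
  apply: le_trans (ler_pM (enorm_ge0 _) (enorm_ge0 _) (enorm_mulmx _ _) leH) _.
  by rewrite le_eqVlt; apply/orP; left; apply/eqP; ring.
have := psdmx_rayleigh x psdG.
rewrite -(opprK (quad_form _ _)) -linE.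
(* After division by [enorm x ^+ 2] this is [enorm x < r], and the doubling is the 2 in the
   denominator of [r]. *)
have : spectral_norm Sigma1 * spectral_norm Hh * enorm x ^+ 3 *+ 2 <
    sigma_min (V^T *m G *m V) * enorm x ^+ 2.
  rewrite [enorm x ^+ 3]exprS mulrA -mulrnAl ltr_pM2r ?exprn_gt0//.
  have ge0 : 0 <= 2 * spectral_norm Sigma1 * spectral_norm Hh.
    by rewrite !mulr_ge0 ?spectral_norm_ge0.
  (* If the denominator were zero, the convention [0^-1 = 0] would give [r = 0] and an empty
     ball. *)
  move: ge0 xr; rewrite le_eqVlt /r => /orP[/eqP <-|gt0].
    by rewrite invr0 mulr0 ltNge enorm_ge0.
  rewrite ltr_pdivlMr//; apply: le_lt_trans.
  by rewrite le_eqVlt; apply/orP; left; apply/eqP; ring.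
rewrite /qb_field mulmxDr [X in _ -> _ -> X < 0]mxE.
(* With [K] the product of the two spectral norms, [2 b <= 2 K |x|^3 < sigma_min |x|^2 <= - 2 a], so
   [a + b < 0]. *)
set a := (_ *m (Ah *m x)) _ _; set b := (x^T *m Sigma1 *m (Hh *m _)) _ _ in nonlin *.
move: nonlin; lra.
Qed.
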